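(* Let $\varepsilon=\frac{1+(-1)^n}{2}$. For all integers $r$, $s$ and $n\ge 0$, the following six identities hold: \begin{align*} \sum_{i=0}^{n}U_{r+2i}U_{s+2i}&=p^{-1}\Delta^{-1}\left[U_{4n+r+s+2}-U_{r+s-2}\right]-(n+1)\Delta^{-1}q^{r}V_{s-r},\\ \sum_{i=0}^{n}V_{r+2i}V_{s+2i}&=p^{-1}\left[U_{4n+r+s+2}-U_{r+s-2}\right]+(n+1)q^{r}V_{s-r},\\ \sum_{i=0}^{n}U_{r+2i}V_{s+2i}&=p^{-1}\Delta^{-1}\left[V_{4n+r+s+2}-V_{r+s-2}\right]-(n+1)q^{r}U_{s-r},\\ \sum_{i=0}^{n}(-1)^{i}U_{r+2i}U_{s+2i}&=\Delta^{-1}V_{2}^{-1}\left[V_{r+s-2}+(-1)^{n}V_{4n+r+s+2}\right]-\varepsilon\Delta^{-1}q^{r}V_{s-r},\\ \sum_{i=0}^{n}(-1)^{i}V_{r+2i}V_{s+2i}&=V_{2}^{-1}\left[V_{r+s-2}+(-1)^{n}V_{4n+r+s+2}\right]+\varepsilon q^{r}V_{s-r},\\ \sum_{i=0}^{n}(-1)^{i}U_{r+2i}V_{s+2i}&=V_{2}^{-1}\left[U_{r+s-2}+(-1)^{n}U_{4n+r+s+2}\right]-\varepsilon q^{r}U_{s-r}. \end{align*}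
   Context: Let $p,q$ be integers with $p\neq 0$, $q\in\{1,-1\}$, and $\Delta:=p^2-4q\neq 0$. The sequences $(U_n)_{n\in\mathbb{Z}}$ and $(V_n)_{n\in\mathbb{Z}}$ are defined by $U_0=0$, $U_1=1$, $V_0=2$, $V_1=p$ and the recurrences $U_n=pU_{n-1}-qU_{n-2}$, $V_n=pV_{n-1}-qV_{n-2}$ for all $n\in\mathbb{Z}$ (so they are extended to negative indices by the recurrence). Under these assumptions $U_2$, $V_2$ and $U_4$ are nonzero. The identities are between rational numbers. *)

(* Defs.v *)
From HB Require Import structures.
From mathcomp Require Import all_boot all_order all_algebra.
From mathcomp Require Import ring.

Set Implicit Arguments.
Unset Strict Implicit.
Unset Printing Implicit Defensive.

Import Order.TTheory GRing.Theory Num.Theory.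
Local Open Scope ring_scope.

(* The recurrence is imposed at every integer n, so it also fixes the values at
   negative indices: see lucas_rec_exists and lucas_rec_unique. *)
Definition lucas_rec (p q : int) (W : int -> int) : Prop :=
  forall n : int, W n = p * W (n - 1) - q * W (n - 2).

Definition is_lucasU (p q : int) (U : int -> int) : Prop :=
  [/\ U 0 = 0, U 1 = 1 & lucas_rec p q U].

Definition is_lucasV (p q : int) (V : int -> int) : Prop :=
  [/\ V 0 = 2, V 1 = p & lucas_rec p q V].

Definition lucas_disc (p q : int) : int := p ^+ 2 - 4 * q.

Definition parity_eps (n : nat) : rat := (1 + (-1) ^+ n) / 2.

Fixpoint lucas_pair (a b x y : int) (n : nat) : int * int :=
  if n is m.+1 then
    let w := lucas_pair a b x y m in (w.2, a * w.2 - b * w.1)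
  else (x, y).

Lemma lucas_rec_exists (p q x y : int) : q = 1 \/ q = -1 ->
  exists W : int -> int, [/\ W 0 = x, W 1 = y & lucas_rec p q W].
Proof.
move=> hq.
pose f := lucas_pair p q x y.
(* Running the recurrence backwards: q^-1 = q. *)
pose g := lucas_pair (q * p) q y x.
pose W (n : int) := match n with Posz m => (f m).1 | Negz m => (g m.+2).1 end.
exists W; split=> //; case=> [[|[|m]]|m].
- rewrite (_ : 0 - 1 = Negz 0) // (_ : 0 - 2 = Negz 1) // /W /g /f /=.
  by case: hq => ->; ring.
- rewrite (_ : 1%:Z - 1 = 0) // (_ : 1%:Z - 2 = Negz 0) // /W /g /f /=.
  by case: hq => ->; ring.
- have -> : m.+2%:Z - 1 = m.+1%:Z by ring.
  by have -> : m.+2%:Z - 2 = m%:Z by ring.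
- have -> : Negz m - 1 = Negz m.+1 by rewrite !NegzE; ring.
  have -> : Negz m - 2 = Negz m.+2 by rewrite !NegzE; ring.
  rewrite /W /g -[m.+4]/(m.+2.+2) -[m.+3]/(m.+2.+1); move: m.+2 => k.
  rewrite [lucas_pair _ _ _ _ k.+2]/= [lucas_pair _ _ _ _ k.+1]/=.
  by case: (lucas_pair _ _ _ _ k) => u v /=; case: hq => ->; ring.
Qed.

Lemma lucas_rec_unique (p q : int) (W W' : int -> int) : q = 1 \/ q = -1 ->
  lucas_rec p q W -> lucas_rec p q W' -> W 0 = W' 0 -> W 1 = W' 1 -> W =1 W'.
Proof.
move=> hq hW hW' h0 h1; have q0 : q != 0 by case: hq => ->.
have P (n : nat) : W n = W' n /\ W n.+1 = W' n.+1.
  elim: n => [//|n [IH1 IH2]]; split=> //; rewrite hW hW'.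
  have -> : n.+2%:Z - 1 = n.+1%:Z by ring.
  have -> : n.+2%:Z - 2 = n%:Z by ring.
  by rewrite IH1 IH2.
have N (n : nat) : W (- n%:Z) = W' (- n%:Z) /\ W (1 - n%:Z) = W' (1 - n%:Z).
  elim: n => [|n [IH1 IH2]]; first by rewrite oppr0 addr0.
  have e : 1 - n.+1%:Z = - n%:Z by ring.
  rewrite e; split=> //; apply: (mulfI q0).
  have := hW (1 - n%:Z); rewrite IH2 hW'.
  have -> : 1 - n%:Z - 1 = - n%:Z by ring.
  have -> : 1 - n%:Z - 2 = - n.+1%:Z by ring.
  by rewrite IH1 => /addrI /oppr_inj.
by case=> n; [case: (P n) | rewrite NegzE; case: (N n.+1)].
Qed.

(* Main.v *)
Require Import Defs.
From HB Require Import structures.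
From mathcomp Require Import all_boot all_order all_algebra.
From mathcomp Require Import zify ring.

Set Implicit Arguments.
Unset Strict Implicit.
Unset Printing Implicit Defensive.

Import Order.TTheory GRing.Theory Num.Theory.
Local Open Scope ring_scope.

(** Attach to every solution W of the recurrence its companion
    W'_n = W_(n+1) - q W_(n-1); the companion of U is V and that of V is
    Delta U. Two product formulas hold for all solutions W and all integers
    m, n:
      V_m W_n  = W_(n+m) + q^m W_(n-m),
      U_m W'_n = W_(n+m) - q^m W_(n-m).
    For fixed n, all terms are solutions of the recurrence in the variable m
    (for q^m W_(n-m) this reads the recurrence of W backwards), so it suffices
    to compare the values at m = 0 and m = 1 ([lucasV_mul], [lucasU_mul]).

    These two formulas are used twice.
    With m = r + 2i, n = s + 2i and q^(2i) = 1 they turn every product under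
    the six sums (after multiplication by Delta, if both factors are terms of
    U) into a term of index r + s + 4i plus the constant +/- q^r V_(s-r) or
    - q^r U_(s-r). With m = 2 and q^2 = 1 they become
      V_2 W_n = W_(n+2) + W_(n-2)  and  p W'_n = W_(n+2) - W_(n-2),
    so that sums over indices in steps of 4, alternating and plain
    respectively, telescope ([lucas_alt_sum], [lucas_companion_sum]).
    The constants contribute n + 1 times themselves to a plain sum and
    (1 + (-1)^n)/2 times themselves to an alternating one. *)

Definition companion (q : int) (W : int -> int) (n : int) : int :=
  W (n + 1) - q * W (n - 1).

(** * Product formulas *)

Lemma lucas_rec_step (p q : int) (W : int -> int) (n : int) :
  lucas_rec p q W -> W (n + 1) = p * W n - q * W (n - 1).
Proof. by move=> hW; rewrite hW; congr (_ * W _ - _ * W _); ring. Qed.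

Lemma lucas_rec_back (p q : int) (W : int -> int) (n : int) :
  lucas_rec p q W -> q * W (n - 1) = p * W n - W (n + 1).
Proof. by move=> hW; rewrite (lucas_rec_step n hW); ring. Qed.

Lemma lucas_rec_shift (p q : int) (W : int -> int) (n : int) :
  lucas_rec p q W -> lucas_rec p q (fun m => W (n + m)).
Proof. by move=> hW m; rewrite hW; congr (_ * W _ - _ * W _); ring. Qed.

Lemma lucas_rec_lin (p q c d : int) (W X : int -> int) :
  lucas_rec p q W -> lucas_rec p q X ->
  lucas_rec p q (fun m => c * W m + d * X m).
Proof. by move=> hW hX m; rewrite hW hX; ring. Qed.

Lemma lucas_unit (q : int) : q = 1 \/ q = -1 -> q \is a GRing.unit.
Proof. by case=> ->. Qed.

(** The recurrence read backwards has characteristic roots 1/alpha and 1/beta;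
    since q = alpha beta, the factor q^m exchanges them back into beta and
    alpha. *)
Lemma lucas_rec_reflect (p q : int) (W : int -> int) (n : int) :
  q \is a GRing.unit ->
  lucas_rec p q W -> lucas_rec p q (fun m => q ^ m * W (n - m)).
Proof.
move=> uq hW m.
have e1 : q ^ m = q * (q * q ^ (m - 2)).
  by rewrite mulrA -(exprzDr uq 2) addrC subrK.
have e2 : q ^ (m - 1) = q * q ^ (m - 2).
  by rewrite -(exprzDr uq 1); congr (q ^ _); ring.
rewrite e1 e2 (_ : n - (m - 2) = (n - m + 1) + 1); last by ring.
rewrite (lucas_rec_step (n - m + 1) hW).
rewrite (_ : n - (m - 1) = n - m + 1); last by ring.
rewrite (_ : n - m + 1 - 1 = n - m); last by ring.
ring.
Qed.

(** All three terms solve the recurrence in m; at m = 0 both sides are 2 W_n,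
    and at m = 1 the formula is the recurrence of W itself. *)
Lemma lucasV_mul (p q : int) (V W : int -> int) (m n : int) :
  q = 1 \/ q = -1 -> is_lucasV p q V -> lucas_rec p q W ->
  V m * W n = W (n + m) + q ^ m * W (n - m).
Proof.
move=> hq [V0 V1 hV] hW; have uq := lucas_unit hq.
(* The zero summand makes this the scalar multiple W_n V_m. *)
have hL := lucas_rec_lin (W n) 0 hV hV.
have hR := lucas_rec_lin 1 1 (lucas_rec_shift n hW)
  (lucas_rec_reflect n uq hW).
have /= := lucas_rec_unique hq hL hR _ _ m.
rewrite V0 V1 expr0z expr1z addr0 subr0 (lucas_rec_step n hW) => E.
have {}E := E ltac:(ring) ltac:(ring).
by transitivity (W n * V m + 0 * V m); [ring | rewrite E; ring].
Qed.

(** As for [lucasV_mul]: at m = 0 both sides vanish, and at m = 1 the formula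
    is the definition of the companion. *)
Lemma lucasU_mul (p q : int) (U W : int -> int) (m n : int) :
  q = 1 \/ q = -1 -> is_lucasU p q U -> lucas_rec p q W ->
  U m * companion q W n = W (n + m) - q ^ m * W (n - m).
Proof.
move=> hq [U0 U1 hU] hW; have uq := lucas_unit hq.
have hL := lucas_rec_lin (companion q W n) 0 hU hU.
have hR := lucas_rec_lin 1 (-1) (lucas_rec_shift n hW)
  (lucas_rec_reflect n uq hW).
have /= := lucas_rec_unique hq hL hR _ _ m.
rewrite U0 U1 expr0z expr1z addr0 subr0 {2}/companion => E.
have {}E := E ltac:(ring) ltac:(ring).
by transitivity (companion q W n * U m + 0 * U m); [ring | rewrite E; ring].
Qed.

(** Taking the companion commutes with the recurrence, so the two closed forms
    below are also decided by their values at 0 and 1. *)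
Lemma companion_rec (p q : int) (W : int -> int) :
  lucas_rec p q W -> lucas_rec p q (companion q W).
Proof.
move=> hW n; rewrite /companion (hW (n + 1)) (hW (n - 1)).
rewrite (_ : n - 1 + 1 = n + 1 - 1); last by ring.
rewrite (_ : n - 2 + 1 = n + 1 - 2); last by ring.
rewrite (_ : n - 2 - 1 = n - 1 - 2); last by ring.
ring.
Qed.

Lemma companionU (p q : int) (U V : int -> int) :
  q = 1 \/ q = -1 -> is_lucasU p q U -> is_lucasV p q V ->
  companion q U =1 V.
Proof.
move=> hq [U0 U1 hU] [V0 V1 hV].
have Um1 : q * U (-1) = -1.
  by rewrite (lucas_rec_back 0 hU) add0r U0 U1 mulr0 sub0r.
have U2 : U 2 = p by rewrite (lucas_rec_step 1 hU) subrr U0 U1; ring.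
apply: (lucas_rec_unique hq (companion_rec hU) hV).
- by rewrite /companion add0r sub0r U1 Um1 V0.
- by rewrite /companion subrr U0 (_ : 1 + 1 = 2) // U2 V1; ring.
Qed.

Lemma companionV (p q : int) (U V : int -> int) :
  q = 1 \/ q = -1 -> is_lucasU p q U -> is_lucasV p q V ->
  companion q V =1 (fun n => lucas_disc p q * U n).
Proof.
move=> hq [U0 U1 hU] [V0 V1 hV].
have Vm1 : q * V (-1) = p.
  by rewrite (lucas_rec_back 0 hV) add0r V0 V1; ring.
have V2 : V 2 = p * p - q * 2 by rewrite (lucas_rec_step 1 hV) subrr V0 V1.
have hL : lucas_rec p q (fun n => lucas_disc p q * U n).
  by move=> n; rewrite hU; ring.
apply: (lucas_rec_unique hq (companion_rec hV) hL).
- by rewrite /companion add0r sub0r V1 Vm1 U0; ring.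
- by rewrite /companion subrr V0 (_ : 1 + 1 = 2) // V2 U1 /lucas_disc; ring.
Qed.

(** * Telescoping sums *)

Lemma lucas_expr_even (q r k : int) :
  q = 1 \/ q = -1 -> q ^ (r + 2 * k) = q ^ r.
Proof.
move=> hq; rewrite (exprzDr (lucas_unit hq)) -exprz_exp.
have -> : q ^ (2 : int) = 1 by case: hq => ->.
by rewrite exp1rz mulr1.
Qed.

Lemma lucas_expr2 (q : int) : q = 1 \/ q = -1 -> q ^ (2 : int) = 1.
Proof. by move=> /(lucas_expr_even 0 1). Qed.

Lemma lucasU2 (p q : int) (U : int -> int) : is_lucasU p q U -> U 2 = p.
Proof.
by case=> U0 U1 hU; rewrite (lucas_rec_step 1 hU) subrr U0 U1; ring.
Qed.

(** V_2 = p^2 - 2q would vanish only if p^2 = 2 or p^2 = -2. *)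
Lemma lucasV2_neq0 (p q : int) (V : int -> int) :
  q = 1 \/ q = -1 -> is_lucasV p q V -> V 2 != 0.
Proof.
move=> hq [V0 V1 hV]; rewrite (lucas_rec_step 1 hV) subrr V0 V1.
have : p \in [:: -1; 0; 1] \/ 4 <= p * p.
  rewrite !inE; case: (lerP p (-2)) => h1; first by right; nia.
  by case: (lerP 2 p) => h2; [right; nia | left; lia].
move=> [|pp]; last by case: hq => ->; lia.
by rewrite !inE => /or3P[]/eqP->; case: hq => ->.
Qed.

(** U_2 = p, so [lucasU_mul] at m = 2 writes p W'_k as the difference of two
    terms of W whose indices differ by 4. *)
Lemma lucas_companion_sum (p q : int) (U W : int -> int) (c : int) (n : nat) :
  p <> 0 -> q = 1 \/ q = -1 -> is_lucasU p q U -> lucas_rec p q W ->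
  \sum_(0 <= i < n.+1) (companion q W (c + 4 * i%:Z))%:Q
    = p%:Q^-1 * ((W (4 * n%:Z + c + 2))%:Q - (W (c - 2))%:Q).
Proof.
move=> hp hq hU hW.
have p0 : p%:Q != 0 by rewrite intr_eq0; apply/eqP.
have step k : p * companion q W k = W (k + 2) - W (k - 2).
  by rewrite -{1}(lucasU2 hU) (lucasU_mul 2 k hq hU hW) lucas_expr2 // mul1r.
apply: (mulfI p0); rewrite mulVKf // mulr_sumr.
rewrite (telescope_sumr_eq (fun i => (W (c - 2 + 4 * i%:Z))%:Q)) //.
  by congr ((W _)%:Q - (W _)%:Q); ring.
move=> i _; rewrite -intrM step intrB.
by congr ((W _)%:Q - (W _)%:Q); ring.
Qed.

(** [lucasV_mul] at m = 2 writes V_2 W_k as a sum of two terms of W whose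
    indices differ by 4; the alternating sign turns it into a difference. *)
Lemma lucas_alt_sum (p q : int) (V W : int -> int) (c : int) (n : nat) :
  q = 1 \/ q = -1 -> is_lucasV p q V -> lucas_rec p q W ->
  \sum_(0 <= i < n.+1) (-1) ^+ i * (W (c + 4 * i%:Z))%:Q
    = (V 2)%:Q^-1 *
        ((W (c - 2))%:Q + (-1) ^+ n * (W (4 * n%:Z + c + 2))%:Q).
Proof.
move=> hq hV hW.
have v0 : (V 2)%:Q != 0 by rewrite intr_eq0; apply: lucasV2_neq0 hq hV.
have step k : V 2 * W k = W (k + 2) + W (k - 2).
  by rewrite (lucasV_mul 2 k hq hV hW) lucas_expr2 // mul1r.
apply: (mulfI v0); rewrite mulVKf // mulr_sumr.
rewrite (telescope_sumr_eq
  (fun i => - ((-1) ^+ i * (W (c - 2 + 4 * i%:Z))%:Q))) //.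
  rewrite expr0 mulr0 addr0 exprS.
  rewrite (_ : c - 2 + 4 * n.+1%:Z = 4 * n%:Z + c + 2); last by ring.
  by ring.
move=> i _; rewrite mulrCA -intrM step intrD exprS.
rewrite (_ : c - 2 + 4 * i.+1%:Z = c + 4 * i%:Z + 2); last by ring.
rewrite (_ : c - 2 + 4 * i%:Z = c + 4 * i%:Z - 2); last by ring.
ring.
Qed.

(** * Sums of affine expressions *)

Lemma sum_affine (a k : rat) (F G : nat -> rat) (n : nat) :
  (forall i, F i = a * G i + k) ->
  \sum_(0 <= i < n.+1) F i = a * (\sum_(0 <= i < n.+1) G i) + n.+1%:R * k.
Proof.
move=> FE; under eq_bigr do rewrite FE.
by rewrite big_split /= -mulr_sumr sumr_const_nat subn0 mulr_natl.
Qed.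

Lemma sum_sign (n : nat) :
  \sum_(0 <= i < n.+1) (-1) ^+ i = parity_eps n.
Proof.
elim: n => [|n IHn]; first by rewrite big_nat1 /parity_eps expr0.
by rewrite big_nat_recr // IHn /parity_eps /= exprS; field.
Qed.

Lemma alt_sum_affine (a k : rat) (F G : nat -> rat) (n : nat) :
  (forall i, F i = a * G i + k) ->
  \sum_(0 <= i < n.+1) (-1) ^+ i * F i
    = a * (\sum_(0 <= i < n.+1) (-1) ^+ i * G i) + parity_eps n * k.
Proof.
move=> FE; under eq_bigr do rewrite FE mulrDr mulrCA.
by rewrite big_split /= -mulr_sumr -mulr_suml sum_sign.
Qed.

Theorem theorem1 (p q : int) (hp : p <> 0) (hq : q = 1 \/ q = -1)
    (hD : lucas_disc p q <> 0) (U V : int -> int)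
    (hU : is_lucasU p q U) (hV : is_lucasV p q V)
    (r s : int) (n : nat) :
  let D : rat := (lucas_disc p q)%:Q in
  let eps : rat := parity_eps n in
  \sum_(0 <= i < n.+1) (U (r + 2 * i%:Z))%:Q * (U (s + 2 * i%:Z))%:Q
    = p%:Q^-1 * D^-1 * ((U (4 * n%:Z + r + s + 2))%:Q - (U (r + s - 2))%:Q)
      - (n.+1)%:R * D^-1 * q%:Q ^ r * (V (s - r))%:Q
  /\
  \sum_(0 <= i < n.+1) (V (r + 2 * i%:Z))%:Q * (V (s + 2 * i%:Z))%:Q
    = p%:Q^-1 * ((U (4 * n%:Z + r + s + 2))%:Q - (U (r + s - 2))%:Q)
      + (n.+1)%:R * q%:Q ^ r * (V (s - r))%:Q
  /\
  \sum_(0 <= i < n.+1) (U (r + 2 * i%:Z))%:Q * (V (s + 2 * i%:Z))%:Q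
    = p%:Q^-1 * D^-1 * ((V (4 * n%:Z + r + s + 2))%:Q - (V (r + s - 2))%:Q)
      - (n.+1)%:R * q%:Q ^ r * (U (s - r))%:Q
  /\
  \sum_(0 <= i < n.+1)
      (-1) ^+ i * (U (r + 2 * i%:Z))%:Q * (U (s + 2 * i%:Z))%:Q
    = D^-1 * (V 2)%:Q^-1 *
        ((V (r + s - 2))%:Q + (-1) ^+ n * (V (4 * n%:Z + r + s + 2))%:Q)
      - eps * D^-1 * q%:Q ^ r * (V (s - r))%:Q
  /\
  \sum_(0 <= i < n.+1)
      (-1) ^+ i * (V (r + 2 * i%:Z))%:Q * (V (s + 2 * i%:Z))%:Q
    = (V 2)%:Q^-1 *
        ((V (r + s - 2))%:Q + (-1) ^+ n * (V (4 * n%:Z + r + s + 2))%:Q)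
      + eps * q%:Q ^ r * (V (s - r))%:Q
  /\
  \sum_(0 <= i < n.+1)
      (-1) ^+ i * (U (r + 2 * i%:Z))%:Q * (V (s + 2 * i%:Z))%:Q
    = (V 2)%:Q^-1 *
        ((U (r + s - 2))%:Q + (-1) ^+ n * (U (4 * n%:Z + r + s + 2))%:Q)
      - eps * q%:Q ^ r * (U (s - r))%:Q.
Proof.
move=> D eps.
have [_ _ recU] := hU; have [_ _ recV] := hV.
have D0 : D != 0 by rewrite intr_eq0; apply/eqP.
have qQ : (q ^ r)%:Q = q%:Q ^ r by case: hq => ->; rewrite -?rmorphXz.
have idx : 4 * n%:Z + r + s + 2 = 4 * n%:Z + (r + s) + 2 by ring.
have sumi (i : int) : s + 2 * i + (r + 2 * i) = r + s + 4 * i by ring.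
have subi (i : int) : s + 2 * i - (r + 2 * i) = s - r by ring.
(* The products as a * G i + k; k is constant in i because q^(2i) = 1. *)
have UU (i : nat) : (U (r + 2 * i%:Z))%:Q * (U (s + 2 * i%:Z))%:Q =
    D^-1 * (V (r + s + 4 * i%:Z))%:Q + - (D^-1 * q%:Q ^ r * (V (s - r))%:Q).
  have := lucasU_mul (r + 2 * i%:Z) (s + 2 * i%:Z) hq hU recV.
  rewrite (companionV hq hU hV) sumi subi lucas_expr_even //.
  move=> /(congr1 (fun x : int => x%:Q)); rewrite intrB !intrM qQ -/D => E.
  by apply: (mulfI D0); rewrite mulrCA E; field.
have VV (i : nat) : (V (r + 2 * i%:Z))%:Q * (V (s + 2 * i%:Z))%:Q =
    1 * (V (r + s + 4 * i%:Z))%:Q + q%:Q ^ r * (V (s - r))%:Q.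
  rewrite -intrM (lucasV_mul _ _ hq hV recV) sumi subi lucas_expr_even //.
  by rewrite intrD intrM qQ mul1r.
have UV (i : nat) : (U (r + 2 * i%:Z))%:Q * (V (s + 2 * i%:Z))%:Q =
    1 * (U (r + s + 4 * i%:Z))%:Q + - (q%:Q ^ r * (U (s - r))%:Q).
  rewrite -intrM -(companionU hq hU hV) (lucasU_mul _ _ hq hU recU).
  by rewrite sumi subi lucas_expr_even // intrB intrM qQ mul1r.
have sumV : \sum_(0 <= i < n.+1) (V (r + s + 4 * i%:Z))%:Q =
    p%:Q^-1 * ((U (4 * n%:Z + r + s + 2))%:Q - (U (r + s - 2))%:Q).
  rewrite idx -(lucas_companion_sum _ _ hp hq hU recU).
  by apply: eq_bigr => i _; rewrite (companionU hq hU hV).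
have sumU : \sum_(0 <= i < n.+1) (U (r + s + 4 * i%:Z))%:Q =
    p%:Q^-1 * D^-1 * ((V (4 * n%:Z + r + s + 2))%:Q - (V (r + s - 2))%:Q).
  rewrite idx mulrAC -(lucas_companion_sum _ _ hp hq hU recV) mulr_suml.
  apply: eq_bigr => i _; rewrite (companionV hq hU hV) intrM -/D.
  by rewrite mulrAC divff // mul1r.
do 3 (under [\sum_(0 <= i < n.+1) (-1) ^+ i * _ * _]eq_bigr do rewrite -mulrA).
rewrite !(sum_affine _ UU, sum_affine _ VV, sum_affine _ UV).
rewrite !(alt_sum_affine _ UU, alt_sum_affine _ VV, alt_sum_affine _ UV).
rewrite sumU sumV !(lucas_alt_sum _ _ hq hV recU, lucas_alt_sum _ _ hq hV recV).
rewrite idx -/eps.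
by do !split; ring.
Qed.
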